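(* Let $L$ be an arbitrary finite-dimensional Lie algebra over an algebraically closed field of characteristic $0$, let $N$ be its nilradical, and suppose that $L$ is exact. Then $$r_t(L/N)\le \dim\bigl(N/[N,N]\bigr).$$ If $L$ is solvable, then the exactness condition is redundant (the inequality holds for every finite-dimensional solvable $L$); in this case $L/N$ is a toric (abelian) Lie algebra and $r_t(L/N)=\dim(L/N)$, so that $\dim(L/N)\le\dim\bigl(N/[N,N]\bigr)$.
   Context: The nilradical of a Lie algebra is its largest nilpotent ideal. Let $L=S+R$ be a Levi decomposition of $L$, with $R$ the (solvable) radical and $S$ a semisimple subalgebra (the semisimple part of $L$). A Lie algebra $L$ with nilradical $N$ is called exact if the kernel of the adjoint action of $S$ on $N$ is trivial (equivalently, the kernel of the action of $S$ on the radical $R$ is trivial; equivalently, $L$ is not a direct sum of a nonzero semisimple Lie algebra and some other Lie algebra). A toric subalgebra of a Lie algebra is an abelian Lie subalgebra consisting of semisimple elements, i.e. elements whose action in the adjoint representation is semisimple (completely reducible). The Lie algebra $L/N$ is always reductive; its toric rank $r_t(L/N)$ is the dimension of a maximal toric subalgebra of $L/N$ (over an algebraically closed field of characteristic $0$ all maximal toric subalgebras are conjugate). *)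

(* Defs.v *)
From HB Require Import structures.
From mathcomp Require Import all_boot all_order all_algebra.

Set Implicit Arguments.
Unset Strict Implicit.
Unset Printing Implicit Defensive.

Import GRing.Theory.
Local Open Scope ring_scope.

HB.mixin Record Vector_isLie (F : fieldType) L of Vector F L := {
  lieb : L -> L -> L;
  lieb_linearl : forall z : L, linear (lieb^~ z);
  lieb_linearr : forall z : L, linear (lieb z);
  liebb : forall x : L, lieb x x = 0;
  lieb_jacobi : forall x y z : L,
    lieb x (lieb y z) + lieb y (lieb z x) + lieb z (lieb x y) = 0
}.

#[short(type="lieAlgType")]
HB.structure Definition Lie (F : fieldType) :=
  { L of Vector_isLie F L & Vector F L }.

Section LieTheory.
Variables (F : fieldType) (L : lieAlgType F).
Implicit Types (x y z : L) (U V I S R N T : {vspace L}).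

Definition ad x : 'End(L) := linfun (lieb x).

(* The linear span of all brackets [u, v] with u in U, v in V (see
   memv_lieprod and lieprodvP below); same encoding as prodv for algebras. *)
Definition lieprodv U V : {vspace L} :=
  <<[seq lieb u v | u <- vbasis U, v <- vbasis V]>>%VS.

Definition lie_subalgebra U : Prop :=
  forall x y, x \in U -> y \in U -> lieb x y \in U.

Definition lie_ideal I : Prop := forall x y, y \in I -> lieb x y \in I.

Definition lie_abelian U : Prop :=
  forall x y, x \in U -> y \in U -> lieb x y = 0.

Definition lie_nilpotent U : Prop :=
  exists n, iter n (fun W => lieprodv U W) U = 0%VS.

Definition lie_solvable U : Prop :=
  exists n, iter n (fun W => lieprodv W W) U = 0%VS.

Definition is_nilradical N : Prop :=
  [/\ lie_ideal N, lie_nilpotent N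
    & forall I, lie_ideal I -> lie_nilpotent I -> (I <= N)%VS].

Definition is_radical R : Prop :=
  [/\ lie_ideal R, lie_solvable R
    & forall I, lie_ideal I -> lie_solvable I -> (I <= R)%VS].

(* As a Lie algebra in its own right, S has no nonzero solvable ideal; the zero
   algebra counts as semisimple. *)
Definition lie_semisimple S : Prop :=
  lie_subalgebra S /\
  forall I, (I <= S)%VS ->
    (forall x y, x \in S -> y \in I -> lieb x y \in I) ->
    lie_solvable I -> I = 0%VS.

Definition levi_decomposition S R : Prop :=
  [/\ is_radical R, lie_semisimple S, (S + R = fullv)%VS & (S :&: R = 0)%VS].

Definition lie_exact N : Prop :=
  exists S R, levi_decomposition S R /\
    forall x, x \in S -> (forall y, y \in N -> lieb x y = 0) -> x = 0.

End LieTheory.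

(* Complete reducibility: every invariant subspace has an invariant
   complement. *)
Definition semisimple_end (F : fieldType) (V : vectType F) (f : 'End(V)) :
    Prop :=
  forall U : {vspace V}, (f @: U <= U)%VS ->
    exists W : {vspace V},
      [/\ (f @: W <= W)%VS, (U + W = fullv)%VS & (U :&: W = 0)%VS].

Section Toric.
Variables (F : fieldType) (L : lieAlgType F).
Implicit Types (T : {vspace L}) (x : L).

Definition lie_toric T : Prop :=
  [/\ lie_subalgebra T, lie_abelian T
    & forall x, x \in T -> semisimple_end (ad x)].

Definition maximal_toric T : Prop :=
  lie_toric T /\ forall T', lie_toric T' -> (T <= T')%VS -> T' = T.

End Toric.

(* A relation, so that no conjugacy of maximal toric subalgebras is presupposed
   in speaking of the toric rank. *)
Definition is_toric_rank (F : fieldType) (L : lieAlgType F) (r : nat) : Prop :=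
  exists2 T : {vspace L}, maximal_toric T & r = \dim T.

Record lieIdeal (F : fieldType) (L : lieAlgType F) := LieIdeal {
  lideal :> {vspace L};
  lidealP : lie_ideal lideal
}.

Section BracketTheory.
Variables (F : fieldType) (L : lieAlgType F).
Implicit Types (x y z : L) (U V W I : {vspace L}).

HB.instance Definition _ x :=
  GRing.isLinear.Build F L L *:%R (lieb x) (lieb_linearr x).

Lemma liebDl x y z : lieb (x + y) z = lieb x z + lieb y z.
Proof. by have := lieb_linearl z 1 x y; rewrite /= !scale1r. Qed.

Lemma lieb0l z : lieb 0 z = 0 :> L.
Proof. by apply: (addrI (lieb 0 z)); rewrite -liebDl !addr0. Qed.

Lemma liebZl a x z : lieb (a *: x) z = a *: lieb x z.
Proof. by have := lieb_linearl z a x 0; rewrite /= lieb0l !addr0. Qed.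

Lemma liebC x y : lieb x y = - lieb y x.
Proof.
apply/eqP; rewrite -addr_eq0; apply/eqP.
by have := liebb (x + y); rewrite liebDl !linearD /= !liebb add0r addr0.
Qed.

Lemma lieb_suml (I : finType) (f : I -> L) y :
  lieb (\sum_i f i) y = \sum_i lieb (f i) y.
Proof.
rewrite liebC linear_sum /= -sumrN.
by apply: eq_bigr => i _; rewrite [RHS]liebC.
Qed.

Lemma adE x y : ad x y = lieb x y.
Proof. by rewrite lfunE. Qed.

Lemma memv_lieprod U V x y :
  x \in U -> y \in V -> lieb x y \in lieprodv U V.
Proof.
move=> /coord_vbasis-> /coord_vbasis->; rewrite lieb_suml memv_suml // => i _.
rewrite linear_sum memv_suml //= => j _.
rewrite liebZl linearZ /= !memvZ // memv_span //.
by apply: allpairs_f; apply: mem_nth; rewrite size_tuple.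
Qed.

Lemma lieprodvP U V W :
  reflect (forall x y, x \in U -> y \in V -> lieb x y \in W)
          (lieprodv U V <= W)%VS.
Proof.
apply: (iffP idP) => [sW x y xU yV | sW].
  exact: subvP sW _ (memv_lieprod xU yV).
apply/span_subvP => _ /allpairsP[[x y] [/= xU yV ->]].
exact: sW (vbasis_mem xU) (vbasis_mem yV).
Qed.

(* Hence dim (I / [U, I]) is the (untruncated) difference
   \dim I - \dim (lieprodv U I) for an ideal I. *)
Lemma lieprodv_ideal U I : lie_ideal I -> (lieprodv U I <= I)%VS.
Proof. by move=> idI; apply/lieprodvP => x y _; apply: idI. Qed.

End BracketTheory.

(* The quotient Lie algebra L / I is realised on the complement I^C, on which
   lie_pi is the projection along I.  The lemmas lie_pi_surj, lie_pi_eq0 and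
   lie_piM say that lie_pi is a surjective Lie algebra morphism with
   kernel I. *)
Definition lieQuot (F : fieldType) (L : lieAlgType F) (I : lieIdeal L) : Type :=
  subvs_of (I^C)%VS.

Section Quotient.
Variables (F : fieldType) (L : lieAlgType F) (I : lieIdeal L).

HB.instance Definition _ := Vector.on (lieQuot I).

Definition lie_pi (x : L) : lieQuot I :=
  Subvs (memv_pi (I^C)%VS (I : {vspace L}) x).

Let capCI : (I^C :&: I = 0)%VS.
Proof. by rewrite capvC capv_compl. Qed.

Lemma lie_pi_linear : linear lie_pi.
Proof. by move=> a x y; apply: val_inj; rewrite /= linearP. Qed.
HB.instance Definition _ :=
  GRing.isLinear.Build F L (lieQuot I) *:%R lie_pi lie_pi_linear.

Lemma lie_piK (q : lieQuot I) : lie_pi (vsval q) = q.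
Proof. by apply: val_inj; rewrite /= daddv_pi_id // subvsP. Qed.

Lemma lie_pi_surj (q : lieQuot I) : exists x, lie_pi x = q.
Proof. by exists (vsval q); exact: lie_piK. Qed.

Lemma vsval_lie_pi x : x - vsval (lie_pi x) \in (I : {vspace L}).
Proof.
have xf : x \in (I^C + I)%VS by rewrite addvC addv_complf memvf.
rewrite -{1}(daddv_pi_add capCI xf) /= addrC addKr.
exact: memv_pi.
Qed.

Let vsval0 : vsval (0 : lieQuot I) = 0.
Proof. exact: (linear0 (@vsval F L (I^C)%VS)). Qed.

Lemma lie_pi_eq0 x : (lie_pi x == 0) = (x \in (I : {vspace L})).
Proof.
apply/eqP/idP => [x0 | xI].
  by have := vsval_lie_pi x; rewrite x0 vsval0 subr0.
apply: val_inj; rewrite [RHS]vsval0 /=; apply/eqP; rewrite -memv0 -capCI memv_cap.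
rewrite memv_pi /= -[daddv_pi _ _ _](subKr x) rpredB //.
exact: (vsval_lie_pi x).
Qed.

Definition lieQuot_lieb (p q : lieQuot I) : lieQuot I :=
  lie_pi (lieb (vsval p) (vsval q)).

Lemma lie_pi_lieb x y : lieQuot_lieb (lie_pi x) (lie_pi y) = lie_pi (lieb x y).
Proof.
apply/esym/eqP; rewrite -subr_eq0 -linearB /= lie_pi_eq0.
set x' := vsval (lie_pi x); set y' := vsval (lie_pi y).
have -> : lieb x y - lieb x' y' = lieb x (y - y') - lieb y' (x - x').
  rewrite [lieb x (y - y')]linearB [lieb y' _]linearB /=.
  by rewrite (liebC y' x) (liebC y' x') opprB opprK [- _ + lieb x _]addrC addrA subrK.
by rewrite rpredB // lidealP // vsval_lie_pi.
Qed.

Let vsvalD a (p q : lieQuot I) : vsval (a *: p + q) = a *: vsval p + vsval q.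
Proof. exact: (linearP (@vsval F L (I^C)%VS)). Qed.

Lemma lieQuot_linearl (r : lieQuot I) : linear (lieQuot_lieb^~ r).
Proof.
by move=> a p q /=; rewrite /lieQuot_lieb vsvalD liebDl liebZl linearP.
Qed.

Lemma lieQuot_linearr (r : lieQuot I) : linear (lieQuot_lieb r).
Proof. by move=> a p q; rewrite /lieQuot_lieb vsvalD lieb_linearr linearP. Qed.

Lemma lieQuot_bb (p : lieQuot I) : lieQuot_lieb p p = 0.
Proof. by rewrite /lieQuot_lieb liebb linear0. Qed.

Lemma lieQuot_jacobi (p q r : lieQuot I) :
  lieQuot_lieb p (lieQuot_lieb q r) + lieQuot_lieb q (lieQuot_lieb r p)
    + lieQuot_lieb r (lieQuot_lieb p q) = 0.
Proof.
rewrite -(lie_piK p) -(lie_piK q) -(lie_piK r) !lie_pi_lieb -!linearD /=.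
by rewrite lieb_jacobi linear0.
Qed.

HB.instance Definition _ := Vector_isLie.Build F (lieQuot I)
  lieQuot_linearl lieQuot_linearr lieQuot_bb lieQuot_jacobi.

Lemma lie_piM x y : lie_pi (lieb x y) = lieb (lie_pi x) (lie_pi y).
Proof. by rewrite -lie_pi_lieb. Qed.

End Quotient.

(* Main.v *)
Require Import Defs.
From HB Require Import structures.
From mathcomp Require Import all_boot all_order all_algebra.
Set Implicit Arguments.
Unset Strict Implicit.
Unset Printing Implicit Defensive.
Import GRing.Theory.
Local Open Scope ring_scope.

(** Write V = N / [N, N].  A toric subalgebra T of L / N acts on V by commuting
operators, since N acts on V by 0.  Commuting operators on a d-dimensional
space can be put in triangular form, and the d diagonal entries are linear
forms on T whose common zeros are the elements acting nilpotently.  So the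
bound dim T <= dim V follows once an element t of T that acts nilpotently on V
is shown to vanish ([dim_commuting], [toric_nilpotent_eq0]).

Lift t to x = s + z with s in the semisimple part S and z in the radical R.

- [L, R] lies in N.  On an irreducible L-module in characteristic 0 a solvable
  ideal acts by scalars, so its brackets with L act by 0
  ([solvable_ideal_bracket]); refining L into a chain of ideals with
  irreducible quotients shows that [L, R] is a nilpotent ideal
  ([iter_lieprod_radical]).  Hence z is central modulo N.
- S acts faithfully on V.  Elements acting as 0 on V move each term of the
  lower central series of N into the next, so a late term of the
  derived series of the kernel K of S on V acts as 0 on N, and is 0 by
  exactness; thus K is a solvable ideal of S, so K = 0 ([semisimple_part_rep_faithful]).
- x acts nilpotently on V, so ad x acts nilpotently on the operators of V, and
  by faithfulness ad s is nilpotent on S.  Thus ad t is nilpotent on L / N; it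
  is also semisimple, so it is 0.  Then s is central in S, so s = 0.
- Now x lies in R and [L, x] lies in N, so N + <x> is an ideal.  It is
  nilpotent because x acts nilpotently on N / [N, N], hence on all quotients of
  the lower central series of N ([nilpotent_extension]).  So x is in N, and
  t = 0.

If L is solvable, the decomposition with S = 0 and R = L shows that L is exact,
and [L, L] = [L, R] lies in N, so L / N is abelian and its adjoint action is 0. *)

(** * Rings and matrices *)

(** Leibniz rule for the derivation [X, -], on a power of an element that
commutes with its own derivative. *)
Lemma mulr_exp_comm (R : pzRingType) (X C D : R) k :
    X * C = C * X + D -> C * D = D * C ->
  X * C ^+ k.+1 = C ^+ k.+1 * X + (D * C ^+ k) *+ k.+1.
Proof.
move=> XC CD; elim: k => [|k IH]; first by rewrite expr1 expr0 mulr1.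
rewrite [C ^+ k.+2]exprSr mulrA IH mulrDl -mulrA XC mulrDr !mulrA.
rewrite -addrA; congr (_ + _).
have -> : C ^+ k.+1 * D = D * C ^+ k.+1 by exact/esym/commrX.
by rewrite mulrnAl -mulrA -exprSr -mulrS.
Qed.

(** The k-fold commutator is a combination of terms C^i M C^j with i + j = k,
and one exponent is at least m when k = 2m.  The induction bounds the exponents
instead of expanding into binomial coefficients. *)
Lemma commutator_iter_eq0 (R : pzRingType) (C M : R) m : C ^+ m = 0 ->
  iter (m + m) (fun X => X * C - C * X) M = 0.
Proof.
move=> Cm; have C0 i : (m <= i)%N -> C ^+ i = 0.
  by move=> mi; rewrite -(subnKC mi) exprD Cm mul0r.
suff H k i j : (m + m <= i + j + k)%N ->
    C ^+ i * iter k (fun X => X * C - C * X) M * C ^+ j = 0.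
  by have := H (m + m) 0 0 (leqnn _); rewrite !expr0 mul1r mulr1.
elim: k i j => [|k IH] i j /=.
  rewrite addn0 => le; case: (leqP m i) => [/C0->|lt]; first by rewrite !mul0r.
  by rewrite [C ^+ j]C0 ?mulr0 //;
    rewrite -(leq_add2l m) (leq_trans le) // leq_add2r ltnW.
rewrite addnS => le; rewrite mulrBr mulrBl !mulrA.
rewrite -exprSr -(mulrA _ C) -exprS.
by rewrite !IH ?subrr // ?addnS ?addSn.
Qed.

(** The ranks of the powers of C cannot decrease for ever. *)
Lemma kermx_pow_stabilize (F : fieldType) n (C : 'M[F]_n) :
  exists2 k, (0 < k)%N & (kermx (C ^+ k.+1) <= kermx (C ^+ k))%MS.
Proof.
suff H m k : (0 < k)%N -> (\rank (C ^+ k) <= m)%N ->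
    exists2 k, (0 < k)%N & (kermx (C ^+ k.+1) <= kermx (C ^+ k))%MS.
  exact: (H _ 1).
elim: m k => [|m IH] k k0 rk.
  exists k => //; move: rk; rewrite leqn0 mxrank_eq0 => /eqP ->.
  by rewrite kermx0 submx1.
have sk : (kermx (C ^+ k) <= kermx (C ^+ k.+1))%MS.
  by apply/sub_kermxP; rewrite exprSr mulmxA mulmx_ker mul0mx.
have [le|nle] := boolP (kermx (C ^+ k.+1) <= kermx (C ^+ k))%MS; first by exists k.
move: nle; rewrite -(geq_leqif (mxrank_leqif_sup sk)) => nle.
apply: (IH k.+1) => //; rewrite -ltnS; apply: leq_trans rk; rewrite ltnNge.
apply: contra nle => le; rewrite !mxrank_ker.
exact: leq_sub2l.
Qed.

Section Matrices.
Variable F : closedFieldType.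

Definition nilpotent_mx n (A : 'M[F]_n) : Prop := exists k, A ^+ k = 0.

(** Restrict A to M: over an algebraically closed field the restriction has an
eigenvalue. *)
Lemma stable_eigenspace_neq0 n (A M : 'M[F]_n) :
  M != 0 -> stablemx M A -> exists a, (M :&: eigenspace A a)%MS != 0.
Proof.
move=> M0 stM; set B := restrictmx M A.
have /closed_rootP[a Ba] : size (char_poly B) != 1%N.
  by rewrite size_char_poly eqSS mxrank_eq0.
exists a; move: Ba; rewrite -eigenvalue_root_char => /eigenvalueP[v vB v0].
have stb : stablemx (row_base M) A by rewrite stablemx_row_base.
have : (v <= eigenspace B a)%MS by apply/eigenspaceP.
rewrite sub_eigenspace_conjmx ?row_base_free // => vM.
have : (v *m row_base M <= M :&: eigenspace A a)%MS.
  by rewrite sub_capmx vM andbT -(eq_row_base M) submxMl.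
apply: contraTneq => ->; rewrite submx0 mulmx_free_eq0 //.
exact: row_base_free.
Qed.

(** An eigenspace of one operator is stable under those commuting with it, so
the space M can be cut down one operator at a time. *)
Lemma common_eigenvector n (As : seq 'M[F]_n) (M : 'M_n) :
    {in As &, forall A B, comm_mx A B} ->
    M != 0 -> {in As, forall A, stablemx M A} ->
  exists v : 'rV_n,
    [/\ v != 0, (v <= M)%MS & {in As, forall A, exists a, v *m A = a *: v}].
Proof.
elim: As M => [|A As IH] M cAs M0 stM.
  by exists (nz_row M); rewrite nz_row_eq0 nz_row_sub.
have [a Ma] := stable_eigenspace_neq0 M0 (stM A (mem_head _ _)).
have [B C sB sC|B sB|v [v0 sv ev]] := IH _ _ Ma.
- by apply: cAs; rewrite inE ?sB ?sC orbT.
- rewrite sub_capmx (submx_trans (submxMr _ (capmxSl _ _))) /=; last first.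
    by apply: stM; rewrite inE sB orbT.
  apply: submx_trans (submxMr _ (capmxSr _ _)) _.
  by apply: comm_mx_stable_eigenspace; apply: cAs; rewrite inE ?sB ?eqxx ?orbT.
move: sv; rewrite sub_capmx => /andP[vM /eigenspaceP vA].
exists v; split=> // B; rewrite inE => /orP[/eqP->|/ev//]; by exists a.
Qed.

Lemma common_eigenvector_vspace (T : vectType F) (V : {vspace T}) n
    (rho : {linear T -> 'M[F]_n}) :
    (0 < n)%N -> {in V &, forall s t, comm_mx (rho s) (rho t)} ->
  exists2 v : 'rV_n, v != 0 & {in V, forall t, exists a, v *m rho t = a *: v}.
Proof.
move=> n0 cV.
have [|||v [v0 _ ev]] := @common_eigenvector _ [seq rho t | t <- vbasis V] 1%:M.
- by move=> _ _ /mapP[s sV ->] /mapP[t tV ->]; apply: cV; apply: vbasis_mem.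
- by rewrite -mxrank_eq0 mxrank1 -lt0n.
- by move=> A _; exact: submx1.
exists v => // t tV; apply/sub_rVP.
rewrite (coord_vbasis tV) !linear_sum summx_sub // => i _.
rewrite !linearZ scalemx_sub //=.
have [|a ->] := ev (rho (vbasis V)`_i); last exact: scalemx_sub.
by apply: map_f; apply: mem_nth; rewrite size_tuple.
Qed.

(** The only eigenvalue is 0, so the characteristic polynomial is a power of X. *)
Lemma mxtrace_nilpotent n (A : 'M[F]_n) : nilpotent_mx A -> \tr A = 0.
Proof.
case: n A => [|n] A [k Ak]; first by rewrite [A]flatmx0 mxtrace0.
have [r defr] := closed_field_poly_normal (char_poly A).
move: defr; rewrite (monicP (char_poly_monic A)) scale1r => defr.
have r0 : {in r, forall z, z = 0}.
  move=> z zr; have : root (char_poly A) z by rewrite defr root_prod_XsubC.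
  rewrite -eigenvalue_root_char => /eigenvalueP[v vA v0].
  have vAk j : v *m A ^+ j = z ^+ j *: v.
    elim: j => [|j IHj]; first by rewrite !expr0 mulmx1 scale1r.
    by rewrite !exprSr mulmxA IHj -scalemxAl vA scalerA.
  have /eqP := vAk k; rewrite Ak mulmx0 eq_sym scaler_eq0 (negPf v0) orbF.
  by rewrite expf_eq0 => /andP[_ /eqP].
have defX : char_poly A = 'X^(n.+1).
  have sr : size r = n.+1.
    by have := size_char_poly A; rewrite defr size_prod_XsubC => -[].
  rewrite defr -sr (eq_big_seq (fun=> 'X)) => [|z /r0 ->]; last by rewrite subr0.
  by rewrite big_const_seq count_predT iter_mulr_1.
have := char_poly_trace A isT; rewrite defX coefXn /=.
by rewrite (ltn_eqF (ltnSn n)) => /esym/eqP; rewrite oppr_eq0 => /eqP.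
Qed.

(** The weights of a commuting family separate its elements when none of them
is nilpotent, and there are at most n weights.  The induction splits off one
weight mu: it is carried by a common eigenvector u of the transposed family, and
the kernel of mu acts on the rows annihilated by u, a space of dimension
n - 1. *)
Lemma dim_commuting (T : vectType F) (V : {vspace T}) n
    (rho : {linear T -> 'M[F]_n}) :
    {in V &, forall s t, comm_mx (rho s) (rho t)} ->
    {in V, forall t, nilpotent_mx (rho t) -> t = 0} ->
  (\dim V <= n)%N.
Proof.
have [m] := ubnP n; elim: m n V rho => // m IH n V rho nm cV nilV.
have [V0|V0] := eqVneq V 0%VS; first by rewrite V0 dimv0.
have n0 : (0 < n)%N.
  rewrite lt0n; apply: contra_neq V0 => n0; subst n.
  apply/eqP; rewrite -subv0; apply/subvP => t tV; rewrite memv0; apply/eqP.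
  by apply: nilV => //; exists 1%N; rewrite flatmx0.
have [|u u0 eu] := common_eigenvector_vspace (V := V) (rho := trmx \o rho) n0.
  by move=> s t sV tV; rewrite /= /comm_mx -!trmx_mul (cV t s).
have [j uj] : exists j, u 0 j != 0.
  apply/existsP; apply: contraR u0; rewrite negb_exists => /forallP u0.
  by apply/eqP/rowP => j; rewrite mxE; apply/eqP; have := u0 j; rewrite negbK.
(* The entry at j recovers the eigenvalue from u rho(t)^T = mu(t) u, and makes its
   linearity in t visible. *)
pose muf t : F^o := (u *m (rho t)^T) 0 j / u 0 j.
have mu_lin : linear muf.
  by move=> a s t; rewrite /muf !linearP /= !mxE mulrDl -mulrA.
pose mu : 'Hom(T, F^o) :=
  linfun (HB.pack muf (GRing.isLinear.Build _ _ _ _ muf mu_lin) : {linear _ -> _}).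
have muE t : t \in V -> u *m (rho t)^T = mu t *: u.
  move=> /eu[a ua]; rewrite lfunE /= /muf ua mxE -mulrA divff // mulr1 //.
pose V1 := (V :&: lker mu)%VS.
have [H [Hfree uH inH]] : exists H : 'M_(\rank (kermx u^T), n),
    [/\ row_free H, H *m u^T = 0
      & forall k (X : 'M_(k, n)), X *m u^T = 0 -> (X <= H)%MS].
  exists (row_base (kermx u^T)); split; first exact: row_base_free.
    by apply/sub_kermxP; rewrite eq_row_base.
  by move=> k X; rewrite eq_row_base => /sub_kermxP.
pose rho1 : {linear T -> 'M[F]_(\rank (kermx u^T))} :=
  (mulmxr (pinvmx H) \o (mulmx H \o rho)).
have rho1E t : t \in V -> rho1 t *m H = H *m rho t.
  move=> /muE ut; apply: mulmxKpV; apply: inH.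
  by rewrite -mulmxA -[rho t]trmxK -trmx_mul ut linearZ /= -scalemxAr uH scaler0.
clearbody rho1.
have ltn : (\rank (kermx u^T) < n)%N.
  by rewrite mxrank_ker mxrank_tr rank_rV u0 ltn_subrL n0.
have dV : (\dim V <= \dim V1 + 1)%N.
  rewrite -(limg_ker_dim mu V) leq_add2l.
  by have := dimvS (subvf (mu @: V)%VS); rewrite dimvf.
apply: leq_trans dV _; rewrite addn1; apply: (leq_ltn_trans _ ltn).
apply: (IH _ V1 rho1); first exact: leq_trans ltn nm.
  move=> s t; rewrite !memv_cap => /andP[sV _] /andP[tV _].
  rewrite /comm_mx; apply: (row_free_inj Hfree).
  by rewrite -!mulmxA !rho1E // !mulmxA !rho1E // -!mulmxA (cV s t).
move=> t; rewrite memv_cap memv_ker => /andP[tV /eqP mut] [k rk].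
apply: nilV => //; exists k.+1.
(* As mu(t) = 0, rho(t) maps every row into H, where its k-th power vanishes. *)
have rhoH : (rho t <= H)%MS.
  by apply: inH; rewrite -[rho t]trmxK -trmx_mul muE // mut scale0r trmx0.
have Hk i : rho1 t ^+ i *m H = H *m rho t ^+ i.
  elim: i => [|i IHi]; first by rewrite !expr0 mul1mx mulmx1.
  by rewrite !exprSr -mulmxA rho1E // mulmxA IHi -mulmxA.
have [D defD] := submxP rhoH.
by rewrite exprS {1}defD -[_ * _]mulmxA -Hk rk mul0mx mulmx0.
Qed.

End Matrices.

(** * Brackets of ideals *)

Section Preliminaries.
Variables (F : fieldType) (L : lieAlgType F).
Implicit Types (x y z : L) (U V W I J : {vspace L}).

Lemma lieb_derivation x y z :
  lieb x (lieb y z) = lieb (lieb x y) z + lieb y (lieb x z).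
Proof.
have := lieb_jacobi x y z; rewrite (liebC z (lieb x y)) (liebC z x) !linearN /=.
by move=> /eqP; rewrite subr_eq0 => /eqP <-; rewrite subrK.
Qed.

Lemma iter_lieb_linear x k : linear (iter k (lieb x)).
Proof. by elim: k => [|k IH] a y z //=; rewrite IH linearP. Qed.

Lemma lieb_memr I x y : lie_ideal I -> x \in I -> lieb x y \in I.
Proof. by move=> idI xI; rewrite liebC rpredN idI. Qed.

Lemma iter_lieb_mem I x k y : lie_ideal I -> y \in I -> iter k (lieb x) y \in I.
Proof. by move=> idI yI; elim: k => //= k; apply: idI. Qed.

Lemma lie_ideal_fullv : lie_ideal (fullv : {vspace L}).
Proof. by move=> x y _; exact: memvf. Qed.

Lemma lie_ideal0 : lie_ideal (0%VS : {vspace L}).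
Proof. by move=> x y /[!memv0] /eqP ->; rewrite linear0. Qed.

Lemma lieprodvS U U' V V' :
  (U <= U')%VS -> (V <= V')%VS -> (lieprodv U V <= lieprodv U' V')%VS.
Proof.
move=> sU sV; apply/lieprodvP => x y /(subvP sU) xU /(subvP sV) yV.
exact: memv_lieprod.
Qed.

(** A linear condition on [U, V] need only be checked on the brackets that span
it. *)
Lemma lieprodv_ind (T : vectType F) (f : 'Hom(L, T)) U V (W : {vspace T}) :
    {in U & V, forall x y, f (lieb x y) \in W} ->
  {in lieprodv U V, forall z, f z \in W}.
Proof.
move=> fUV z; rewrite memv_preim; move: z; apply/subvP/lieprodvP => x y xU yV.
by rewrite -memv_preim; exact: fUV.
Qed.

Lemma lie_ideal_lieprodv I J :
  lie_ideal I -> lie_ideal J -> lie_ideal (lieprodv I J).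
Proof.
move=> idI idJ x z; rewrite -adE; move: z; apply: lieprodv_ind => i j iI jJ.
by rewrite adE lieb_derivation rpredD // memv_lieprod // ?idI ?idJ.
Qed.

Lemma iter_lieprodvS U V V' k : (V <= V')%VS ->
  (iter k (lieprodv U) V <= iter k (lieprodv U) V')%VS.
Proof. by move=> sV; elim: k => //= k; exact: lieprodvS. Qed.

End Preliminaries.

(** * Representations on sections of ideals *)

Section Representations.
Variables (F : fieldType) (L : lieAlgType F).
Implicit Types (x y z : L) (U V W I J : {vspace L}).

(** Matrices act on row vectors from the right, so products come in the reverse
order of composition: this is the morphism law for that action. *)
Definition lie_rep n (rho : L -> 'M[F]_n) : Prop :=
  forall x y, rho (lieb x y) = rho y *m rho x - rho x *m rho y.

(** Coordinates on the section W / W' (the map [phi]) and the matrices [rho] of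
the adjoint action of L in these coordinates.  Working with [phi] on all of L
avoids forming W / W' as a space of its own. *)
Record section_rep n (W' W : {vspace L})
    (phi : {linear L -> 'rV[F]_n}) (rho : {linear L -> 'M[F]_n}) : Prop := SectionRep {
  section_onto : forall v, exists2 w, w \in W & phi w = v;
  section_ker : {in W, forall w, (phi w == 0) = (w \in W')};
  section_act : forall x, {in W, forall w, phi (lieb x w) = phi w *m rho x}
}.

Lemma section_rep_exists W' W : lie_ideal W' -> (W' <= W)%VS ->
  exists (phi : {linear L -> 'rV[F]_(\dim W - \dim W')})
         (rho : {linear L -> 'M[F]_(\dim W - \dim W')}), section_rep W' W phi rho.
Proof.
move=> idW' sW.
have <- : \dim (W :\: W') = (\dim W - \dim W')%N.
  by rewrite -(dimv_cap_compl W W') (capv_idPr sW) addKn.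
set U := (W :\: W')%VS; set n := \dim U.
have UW' : (U :&: W' = 0)%VS by rewrite capv_diff.
have defW : (U + W' = W)%VS by rewrite -[RHS](addv_diff_cap W W') (capv_idPr sW).
pose b := vbasis U.
pose phi0 x : 'rV[F]_n := \row_j coord b j (daddv_pi U W' x).
have phi_lin : linear phi0.
  by move=> a x y; apply/rowP => j; rewrite !mxE !linearP.
pose phi : {linear L -> 'rV[F]_n} :=
  HB.pack phi0 (GRing.isLinear.Build _ _ _ _ phi0 phi_lin).
have phiE x : phi x = phi0 x by [].
clearbody phi.
pose rho0 x : 'M[F]_n := \matrix_i phi (lieb x b`_i).
have rho_lin : linear rho0.
  move=> a x y; apply/row_matrixP => i.
  by rewrite linearP /= !rowK liebDl liebZl linearP.
pose rho : {linear L -> 'M[F]_n} :=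
  HB.pack rho0 (GRing.isLinear.Build _ _ _ _ rho0 rho_lin).
have rhoE x : rho x = rho0 x by [].
clearbody rho.
have phiU u : u \in U -> u = \sum_i phi u 0 i *: b`_i.
  move=> uU; rewrite {1}(coord_vbasis uU); apply: eq_bigr => i _.
  by rewrite phiE mxE daddv_pi_id.
have phiW' w : w \in W' -> phi w = 0.
  move=> wW'; have wUW : w \in (U + W')%VS by rewrite memvE (subv_trans _ (addvSr _ _)).
  have: daddv_pi U W' w = 0.
    have := daddv_pi_add UW' wUW.
    rewrite (@daddv_pi_id _ _ W' U) //; last by rewrite capvC.
    by move=> /(canRL (addrK _)); rewrite subrr.
  by move=> w0; rewrite phiE; apply/rowP => j; rewrite !mxE w0 linear0.
have split w : w \in W -> exists2 u, u \in U & w - u \in W'.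
  rewrite -defW => /memv_addP[u uU [w' w'W ->]]; exists u => //.
  by rewrite addrC addKr.
have phi_split u w : w - u \in W' -> phi w = phi u.
  by move=> /phiW'; rewrite linearB => /eqP; rewrite subr_eq0 => /eqP.
exists phi, rho; split.
- move=> v; exists (\sum_i v 0 i *: b`_i).
    rewrite -defW; apply: subvP (addvSl _ _) _ _; apply: memv_suml => i _.
    by rewrite memvZ // vbasis_mem // mem_nth ?size_tuple.
  have vU : \sum_i v 0 i *: b`_i \in U.
    by apply: memv_suml => i _; rewrite memvZ // vbasis_mem // mem_nth ?size_tuple.
  apply/rowP => j; rewrite phiE mxE daddv_pi_id //.
  by rewrite coord_sum_free // (basis_free (vbasisP U)).
- move=> w /split[u uU wu]; rewrite (phi_split _ _ wu).
  apply/eqP/idP => [u0|wW'].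
    by move: wu; rewrite (phiU u uU) u0 big1 ?subr0 // => i _; rewrite mxE scale0r.
  apply: phiW'; rewrite -(subKr w u) rpredB //.
- move=> x w /split[u uU wu]; rewrite (phi_split _ _ wu).
  have /phi_split -> : lieb x w - lieb x u \in W' by rewrite -linearB idW'.
  rewrite {1}(phiU u uU) linear_sum [LHS]linear_sum [RHS]mulmx_sum_row.
  by apply: eq_bigr => i _; rewrite !linearZ /= rhoE rowK.
Qed.

Section SectionTheory.
Variables (n : nat) (W' W : {vspace L}).
Variables (phi : {linear L -> 'rV[F]_n}) (rho : {linear L -> 'M[F]_n}).
Hypotheses (idW : lie_ideal W) (srep : section_rep W' W phi rho).

Lemma section_lie_rep : lie_rep rho.
Proof.
move=> x y; apply/row_matrixP => i; rewrite !rowE.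
have [w wW <-] := section_onto srep (delta_mx 0 i).
rewrite mulmxBr !mulmxA -!(section_act srep) ?idW // -linearB /=.
by rewrite lieb_derivation addrK.
Qed.

Lemma section_rep_eq0 x :
  rho x = 0 <-> {in W, forall w, lieb x w \in W'}.
Proof.
split=> [x0 w wW | xW].
  by rewrite -(section_ker srep) ?idW // (section_act srep) // x0 mulmx0.
apply/row_matrixP => i; rewrite rowE.
have [w wW <-] := section_onto srep (delta_mx 0 i).
by rewrite -(section_act srep) // row0; apply/eqP; rewrite (section_ker srep) ?idW ?xW.
Qed.

Lemma section_iter x k :
  {in W, forall w, phi (iter k (lieb x) w) = phi w *m rho x ^+ k}.
Proof.
move=> w wW; elim: k => [|k IH]; first by rewrite mulmx1.
by rewrite iterS (section_act srep) ?iter_lieb_mem // IH exprSr mulmxA.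
Qed.

End SectionTheory.
End Representations.

(** * Solvable ideals in irreducible representations *)

Section Irreducible.
Variables (F : closedFieldType) (charF0 : [pchar F] =i pred0).
Variables (L : lieAlgType F) (n : nat) (rho : {linear L -> 'M[F]_n}).
Hypotheses (n_gt0 : (0 < n)%N) (rhoM : lie_rep rho).
Hypothesis irr : forall M : 'M[F]_n,
  (forall x, stablemx M (rho x)) -> M != 0 -> (1%:M <= M)%MS.
Implicit Types (x y a b : L) (A R : {vspace L}).

Lemma mxtrace_lieb x y : \tr (rho (lieb x y)) = 0.
Proof. by rewrite rhoM linearB /= mxtrace_mulC subrr. Qed.

Lemma scalar_trace0 (c : F) : \tr (c%:M : 'M[F]_n) = 0 -> c = 0.
Proof.
rewrite mxtrace_scalar -mulr_natr => /eqP; rewrite mulf_eq0.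
by rewrite (iffLR (pcharf0P F) charF0) (gtn_eqF n_gt0) orbF => /eqP.
Qed.

(** Let b = [x, a].  A generalized eigenspace of rho(b) is L-stable: [b, y] lies
in A, so it commutes with b, and the Leibniz rule shows that rho(y) raises the
order of a generalized eigenvector by at most 1.  By irreducibility c is the only
eigenvalue of rho(b), whose trace n c is that of a commutator, namely 0. *)
Lemma eigenvalue_lieb_eq0 A x a v c :
    lie_ideal A -> {in A &, forall s t, comm_mx (rho s) (rho t)} ->
    a \in A -> v != 0 -> v *m rho (lieb x a) = c *: v :> 'rV_n -> c = 0.
Proof.
move=> idA cA aA v0 vb; set b := lieb x a in vb.
have bA : b \in A by exact: idA.
set C := rho b - c%:M.
have [k k0 stab] := kermx_pow_stabilize C.
have stM y : stablemx (kermx (C ^+ k)) (rho y).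
  have XC : rho y *m C = C *m rho y + rho (lieb b y).
    by rewrite rhoM mulmxBr mulmxBl -scalar_mxC [RHS]addrC addrA subrK.
  have CD : comm_mx C (rho (lieb b y)).
    rewrite /comm_mx mulmxBr mulmxBl scalar_mxC; congr (_ - _).
    by apply: cA => //; apply: lieb_memr.
  apply: submx_trans stab; apply/sub_kermxP.
  have E : rho y *m C ^+ k.+1 =
      C ^+ k *m (C *m rho y + rho (lieb b y) *+ k.+1).
    rewrite [LHS](mulr_exp_comm k XC CD) exprSr -mulrA.
    by rewrite (commrX k (esym CD)) -mulrnAr -mulrDr.
  by rewrite -mulmxA E mulmxA mulmx_ker mul0mx.
have vC : (v <= kermx (C ^+ k))%MS.
  apply/sub_kermxP; case: (k) k0 => // j _.
  rewrite exprS mulmxA mulmxBr vb mul_mx_scalar subrr mul0mx //.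
have /(irr stM) : kermx (C ^+ k) != 0.
  by apply: contraNneq v0 => k00; move: vC; rewrite k00 submx0.
move/sub_kermxP; rewrite mul1mx => Ck.
have : \tr C = 0 by apply: mxtrace_nilpotent; exists k.
rewrite linearB /= mxtrace_lieb sub0r => /eqP; rewrite oppr_eq0 => /eqP.
exact: scalar_trace0.
Qed.

(** A common eigenvector of A is killed by B = [L, A].  The vectors killed by
the ideal B form a submodule, so rho(B) = 0, that is, rho(A) commutes with
rho(L); then Schur's lemma applies. *)
Lemma comm_ideal_scalar A :
    lie_ideal A -> {in A &, forall s t, comm_mx (rho s) (rho t)} ->
  {in A, forall a, is_scalar_mx (rho a)}.
Proof.
move=> idA cA.
have [v v0 ev] := common_eigenvector_vspace n_gt0 cA.
pose B := lieprodv fullv A.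
have idB : lie_ideal B by apply: lie_ideal_lieprodv => //; exact: lie_ideal_fullv.
pose K := (\bigcap_(i < \dim B) kermx (rho (vbasis B)`_i))%MS.
have inK w : (forall b, b \in B -> w *m rho b = 0 :> 'rV_n) <-> (w <= K)%MS.
  split=> [wB | /sub_bigcapmxP wK b bB].
    apply/sub_bigcapmxP => i _; apply/sub_kermxP/wB/vbasis_mem.
    by rewrite mem_nth ?size_tuple.
  rewrite (coord_vbasis bB) !linear_sum big1 // => i _.
  by rewrite !linearZ /= (sub_kermxP (wK i isT)) scaler0.
have vK : (v <= K)%MS.
  apply/inK => b.
  pose f := linfun (mulmx v \o rho).
  suff : {in B, forall b, f b \in (0%VS : {vspace 'rV[F]_n})}.
    by move=> fB bB; have := fB b bB; rewrite memv0 lfunE /= => /eqP.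
  apply: lieprodv_ind => x a _ aA; rewrite memv0 lfunE /=.
  have [c vc] := ev _ (idA x a aA).
  by rewrite vc (eigenvalue_lieb_eq0 idA cA aA v0 vc) scale0r.
have rB b : b \in B -> rho b = 0.
  move=> bB; have /row_subP sK : (1%:M <= K)%MS.
    apply: irr => [y|]; last first.
      by apply: contraNneq v0 => K0; move: vK; rewrite K0 submx0.
    apply/row_subP => i; rewrite row_mul; apply/inK => c cB.
    have /inK wK : (row i K <= K)%MS by exact: row_sub.
    have := wK _ (lieb_memr y idB cB).
    by rewrite rhoM mulmxBr !mulmxA (wK c cB) mul0mx subr0.
  by apply/row_matrixP => i; rewrite row0 rowE;
    have /inK := sK i; rewrite rowE mulmx1 => ->.
move=> a aA; have [c vc] := ev a aA.
apply/is_scalar_mxP; exists c; apply/eqP; rewrite -subr_eq0 -[_ - _]mul1mx.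
apply/eqP/sub_kermxP; apply: irr => [y|].
  have ay : rho y *m rho a = rho a *m rho y.
    apply/eqP; rewrite -subr_eq0 -rhoM liebC linearN rB ?oppr0 //.
    by rewrite memv_lieprod ?memvf.
  by apply: comm_mx_stable_ker; rewrite /comm_mx mulmxBr mulmxBl scalar_mxC ay.
apply: contraNneq v0 => K0; have : (v <= kermx (rho a - c%:M))%MS.
  by apply/sub_kermxP; rewrite mulmxBr vc mul_mx_scalar subrr.
by rewrite K0 submx0.
Qed.

(** Going up the derived series: if a bracket in [R, R] acts by the scalar c,
then n c is the trace of a commutator, so c = 0; hence R acts by commuting
operators. *)
Lemma solvable_ideal_scalar R :
  lie_ideal R -> lie_solvable R -> {in R, forall r, is_scalar_mx (rho r)}.
Proof.
move=> idR [m]; elim: m R idR => [|m IH] R idR.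
  move=> /= -> r; rewrite memv0 => /eqP ->; rewrite linear0.
  by apply/is_scalar_mxP; exists 0; rewrite raddf0.
rewrite iterSr => /IH {}IH; apply: comm_ideal_scalar => // s t sR tR.
have [c sc] : exists c, rho (lieb t s) = c%:M.
  apply/is_scalar_mxP/IH; last exact: memv_lieprod.
  exact: lie_ideal_lieprodv.
apply/eqP; rewrite -subr_eq0 -rhoM sc.
have := mxtrace_lieb t s; rewrite sc => /scalar_trace0 ->.
by rewrite raddf0.
Qed.

Lemma solvable_ideal_bracket R x r :
  lie_ideal R -> lie_solvable R -> r \in R -> rho (lieb x r) = 0.
Proof.
move=> idR solR rR; have /is_scalar_mxP[c rc] := solvable_ideal_scalar idR solR rR.
by rewrite rhoM rc scalar_mxC subrr.
Qed.

End Irreducible.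

(** * The bracket of L with a solvable ideal *)

Section Radical.
Variables (F : closedFieldType) (charF0 : [pchar F] =i pred0).
Variable L : lieAlgType F.
Implicit Types (x y r : L) (N R W I : {vspace L}).

(** A stable row space M of W / W' pulls back to the ideal I of those w in W
whose coordinates lie in M. *)
Lemma section_irreducible n W' W
    (phi : {linear L -> 'rV[F]_n}) (rho : {linear L -> 'M[F]_n}) :
    lie_ideal W -> (W' <= W)%VS -> section_rep W' W phi rho ->
    (forall I, lie_ideal I -> (W' <= I)%VS -> (I <= W)%VS -> I = W' \/ I = W) ->
  forall M : 'M_n, (forall x, stablemx M (rho x)) -> M != 0 -> (1%:M <= M)%MS.
Proof.
move=> idW sW srep minW M stM M0.
pose I := (W :&: lker (linfun (mulmxr (cokermx M) \o phi)))%VS.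
have inI w : (w \in I) = (w \in W) && (phi w <= M)%MS.
  by rewrite memv_cap memv_ker lfunE /= submxE.
have idI : lie_ideal I.
  move=> x w; rewrite !inI => /andP[wW wM]; rewrite idW // (section_act srep) //.
  exact: submx_trans (submxMr _ wM) (stM x).
have [||defI|defI] := minW I idI.
- apply/subvP => w wW'; have wW := subvP sW w wW'.
  have : phi w == 0 by rewrite (section_ker srep).
  by rewrite inI wW => /eqP ->; rewrite sub0mx.
- exact: capvSl.
- have [w wW pw] := section_onto srep (nz_row M).
  have : w \in W' by rewrite -defI inI wW pw nz_row_sub.
  by rewrite -(section_ker srep) // pw nz_row_eq0 (negPf M0).
apply/row_subP => i; have [w wW <-] := section_onto srep (row i 1%:M).
by move: wW; rewrite -{1}defI inI => /andP[].
Qed.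

(** If W' is a maximal ideal of L properly inside W, then W / W' is irreducible
and [L, R] maps W into W'; repeat with W'.  Each step lowers the dimension, so
dim W steps suffice.  Fixing that number makes the goal a decidable equality, for
which the case distinction on the existence of a larger W' is constructively
valid. *)
Lemma iter_lieprod_radical R W : lie_ideal R -> lie_solvable R -> lie_ideal W ->
  iter (\dim W) (lieprodv (lieprodv fullv R)) W = 0%VS.
Proof.
move=> idR solR; have [d] := ubnP (\dim W); elim: d W => // d IHd W dW idW.
have [->|W0] := eqVneq W 0%VS; first by rewrite dimv0.
set B := lieprodv fullv R.
suff : forall W', lie_ideal W' -> (W' <= W)%VS -> W' != W ->
    iter (\dim W) (lieprodv B) W == 0%VS.
  by move=> H; apply/eqP/(H 0%VS); rewrite ?sub0v 1?eq_sym //; apply: lie_ideal0.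
move=> W'; have [e] := ubnP (\dim W - \dim W').
elim: e W' => // e IHe W' eW' idW' sW nW.
have dWW' : (\dim W' < \dim W)%N by rewrite (ltn_leqif (dimv_leqif_eq sW)).
apply: (@classic_EM (exists I : {vspace L},
  [/\ lie_ideal I, (W' <= I)%VS, (I <= W)%VS, I != W' & I != W])).
case=> [[I [idI sI sIW nI nIW]]|nI].
  apply: (IHe I) => //; rewrite -ltnS; apply: leq_trans eW'; rewrite ltnS.
  by rewrite ltn_sub2l // (ltn_leqif (dimv_leqif_eq sI)) eq_sym.
have [phi [rho srep]] := section_rep_exists idW' sW.
have irr := section_irreducible idW sW srep.
have n0 : (0 < \dim W - \dim W')%N by rewrite subn_gt0.
have BW : (lieprodv B W <= W')%VS.
  apply/lieprodvP => b w bB wW; move: w wW.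
  apply/(section_rep_eq0 idW srep).
  pose f := linfun rho.
  suff : {in B, forall b, f b \in (0%VS : {vspace 'M[F]_(\dim W - \dim W')})}.
    by move=> fB; have := fB b bB; rewrite memv0 lfunE => /eqP.
  apply: lieprodv_ind => x r _ rR; rewrite memv0 lfunE /=.
  have repM := section_lie_rep idW srep.
  rewrite (solvable_ideal_bracket charF0 n0 repM _ _ idR solR rR) //.
  apply: irr => I idI sI sIW.
  have [|n1] := eqVneq I W'; first by left.
  have [|n2] := eqVneq I W; first by right.
  by case: nI; exists I.
rewrite -subv0 -(IHd W' (leq_trans dWW' dW) idW') -{1}(subnKC dWW') addSnnS iterD.
apply: iter_lieprodvS; elim: (_ - _)%N => [//|j IHj].
by apply: subv_trans (lieprodv_ideal B idW'); rewrite iterS lieprodvS.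
Qed.

Lemma bracket_solvable_nilradical N R x r :
  is_nilradical N -> lie_ideal R -> lie_solvable R -> r \in R ->
  lieb x r \in N.
Proof.
move=> [_ _ maxN] idR solR rR.
apply: (subvP (maxN (lieprodv fullv R) _ _)); last by rewrite memv_lieprod ?memvf.
  by apply: lie_ideal_lieprodv => //; exact: lie_ideal_fullv.
exists (\dim (lieprodv fullv R)); apply: iter_lieprod_radical => //.
by apply: lie_ideal_lieprodv => //; exact: lie_ideal_fullv.
Qed.

End Radical.

(** * The lower central series of an ideal *)

HB.instance Definition _ (F : fieldType) (L : lieAlgType F) (x : L) k :=
  GRing.isLinear.Build F L L *:%R (iter k (lieb x)) (iter_lieb_linear x k).

Section LowerCentralSeries.
Variables (F : fieldType) (L : lieAlgType F) (N : {vspace L}).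
Hypothesis idN : lie_ideal N.
Implicit Types (x y c : L) (i j k m : nat).

Definition lcs i : {vspace L} := iter i (lieprodv N) N.

Lemma lcs_ideal i : lie_ideal (lcs i).
Proof. by elim: i => //= i; exact: lie_ideal_lieprodv. Qed.

Lemma lcs_anti i k : (lcs (i + k) <= lcs i)%VS.
Proof.
elim: k => [|k IH]; first by rewrite addn0.
rewrite addnS; apply: subv_trans IH.
exact: lieprodv_ideal (@lcs_ideal _).
Qed.

Lemma lcs_bracket i x c : x \in N -> c \in lcs i -> lieb x c \in lcs i.+1.
Proof. exact: memv_lieprod. Qed.

(** [[N, N], C] lies in [N, [N, C]], by the Jacobi identity. *)
Lemma lcs_bracket1 i x c : x \in lcs 1 -> c \in lcs i -> lieb x c \in lcs i.+2.
Proof.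
move=> x1 ci; rewrite liebC rpredN -adE; move: x x1; apply: lieprodv_ind => y z yN zN.
rewrite adE lieb_derivation rpredD //; last first.
  by rewrite lcs_bracket // liebC rpredN lcs_bracket.
by rewrite liebC rpredN lcs_bracket // liebC rpredN lcs_bracket.
Qed.

(** If x acts nilpotently on N / [N, N], it does so on each quotient of the lower
central series, because C_(i+1) = [N, C_i] is an image of the tensor product
of N and C_i.  In the Leibniz expansion of the (m + k)-th iterate, x is applied
at least m times to the left factor or at least k times to the right one. *)
Lemma lcs_iter_lieb x m i :
    {in N, forall y, iter m (lieb x) y \in lcs 1} ->
  exists k, {in lcs i, forall c, iter k (lieb x) c \in lcs i.+1}.
Proof.
move=> xm; elim: i => [|i [k xk]]; first by exists m.
exists (m + k)%N => c ci.
suff : linfun (iter (m + k) (lieb x)) c \in lcs i.+2 by rewrite lfunE.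
move: c ci; apply: lieprodv_ind => y c yN ci; rewrite lfunE /=.
suff H j a b : (m + k <= a + b + j)%N ->
    iter j (lieb x) (lieb (iter a (lieb x) y) (iter b (lieb x) c)) \in lcs i.+2.
  exact: (H (m + k)%N 0%N 0%N).
elim: j a b => [|j IH] a b.
  rewrite addn0 => le; case: (leqP m a) => [ma|am].
    apply: lcs_bracket1; last exact: iter_lieb_mem (@lcs_ideal i) ci.
    by rewrite -(subnK ma) iterD iter_lieb_mem ?xm //; exact: lcs_ideal.
  have kb : (k <= b)%N by rewrite -(leq_add2l m) (leq_trans le) // leq_add2r ltnW.
  apply: lcs_bracket; first exact: iter_lieb_mem.
  by rewrite -(subnK kb) iterD iter_lieb_mem ?xk //; exact: lcs_ideal.
rewrite addnS => le; rewrite iterSr lieb_derivation linearD rpredD //=.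
  by rewrite -iterS IH // addSn addSn.
by rewrite -(iterS b) IH // addnS addSn.
Qed.

Section Extension.
Variables (x : L) (m : nat).
Hypothesis nilN : lie_nilpotent N.
Hypothesis xN : forall y, lieb y x \in N.
Hypothesis xm : {in N, forall y, iter m (lieb x) y \in lcs 1}.
Let J := (N + <[x]>)%VS.

Let inJ y : y \in J -> exists2 n, n \in N & exists a, y = n + a *: x.
Proof.
by move=> /memv_addP[n nN [_ /vlineP[a ->] ->]]; exists n => //; exists a.
Qed.

Lemma ideal_extension : lie_ideal J.
Proof.
move=> y _ /inJ[n nN [a ->]]; apply: (subvP (addvSl N <[x]>)).
by rewrite linearD linearZ /= rpredD ?rpredZ // idN.
Qed.

(** Bracketing C_i with N leads into C_(i+1), so modulo C_(i+1) only x counts;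
it is nilpotent there.  So iterated brackets with J descend through
all the terms of the lower central series of N. *)
Lemma nilpotent_extension : lie_nilpotent J.
Proof.
have step i : exists k, (iter k (lieprodv J) (lcs i) <= lcs i.+1)%VS.
  have [k xk] := lcs_iter_lieb i xm; exists k.
  (* D p consists of the elements of C_i that x sends into C_(i+1) in p steps; each
     bracket with J maps D p.+1 into D p. *)
  pose D p := (lcs i :&: linfun (iter p (lieb x)) @^-1: lcs i.+1)%VS.
  have inD p y : (y \in D p) = (y \in lcs i) && (iter p (lieb x) y \in lcs i.+1).
    by rewrite memv_cap -memv_preim lfunE.
  suff H j p : (j + p)%N = k -> (iter j (lieprodv J) (lcs i) <= D p)%VS.
    apply: subv_trans (H k 0%N (addn0 k)) _.
    by apply/subvP => y; rewrite inD => /andP[].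
  elim: j p => [|j IH] p jp.
    by apply/subvP => y yi; rewrite add0n in jp; rewrite inD yi jp xk.
  apply/lieprodvP => y c /inJ[n nN [a ->]] cD.
  have : c \in D p.+1 by apply: (subvP (IH p.+1 _)); rewrite ?addnS.
  rewrite !inD liebDl liebZl => /andP[ci cx]; rewrite rpredD ?rpredZ ?lcs_ideal //=.
  rewrite linearD linearZ /= -iterSr rpredD ?rpredZ // iter_lieb_mem //.
    exact: (@lcs_ideal i.+1).
  exact: lcs_bracket.
have all i : exists k, (iter k (lieprodv J) N <= lcs i)%VS.
  elim: i => [|i [k IH]]; first by exists 0%N.
  have [l Hl] := step i; exists (l + k)%N; rewrite iterD.
  exact: subv_trans (iter_lieprodvS _ _ IH) Hl.
have [i Ni] := nilN; have [k] := all i.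
rewrite /lcs Ni subv0 => /eqP kJ; exists k.+1; apply/eqP; rewrite -subv0 -kJ iterSr.
apply: iter_lieprodvS; apply/lieprodvP => y _ _ /inJ[n nN [a ->]].
by rewrite linearD linearZ /= rpredD ?rpredZ // idN.
Qed.

End Extension.

(** A subspace K that maps N into [N, N] shifts the lower central series by one
step, and brackets of operators add up their shifts.  So a late term of the
derived series of K annihilates a nilpotent N. *)
Lemma derived_lcs (K : {vspace L}) j i y c :
    {in K & N, forall y n, lieb y n \in lcs 1} ->
    y \in iter j (fun W => lieprodv W W) K -> c \in lcs i ->
  lieb y c \in lcs (i + j).+1.
Proof.
move=> KN; elim: j i y c => [|j IH] i y c /=.
  move=> yK; rewrite addn0; elim: i c => [|i IHi] c; first exact: KN.
  rewrite -adE; move: c; apply: lieprodv_ind => n c nN ci.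
  rewrite adE lieb_derivation rpredD //; last by apply: memv_lieprod => //; exact: IHi.
  by apply: lcs_bracket1 => //; exact: KN.
move=> yK ci; rewrite liebC rpredN -adE; move: y yK; apply: lieprodv_ind => a b aD bD.
have H u v : u \in iter j (fun W => lieprodv W W) K ->
    v \in iter j (fun W => lieprodv W W) K -> lieb u (lieb v c) \in lcs (i + j.+1).+1.
  move=> uD vD; apply: (subvP (lcs_anti _ j)).
  have := IH _ u _ uD (IH _ v c vD ci).
  by rewrite addnS !addSn.
rewrite adE liebC rpredN.
have -> : lieb (lieb a b) c = lieb a (lieb b c) - lieb b (lieb a c).
  by rewrite (lieb_derivation a b c) addrK.
by rewrite rpredB ?H.
Qed.

End LowerCentralSeries.

(** * Toric subalgebras modulo the nilradical *)

(** A nilpotent f is not injective on a nonzero invariant subspace, so an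
invariant complement of its kernel is 0. *)
Lemma semisimple_nilpotent_eq0 (F : fieldType) (V : vectType F) (f : 'End(V)) k :
  semisimple_end f -> (forall v, iter k f v = 0) -> forall v, f v = 0.
Proof.
move=> ssf fk.
have [|W [fW kW1 kW0]] := ssf (lker f).
  by apply/subvP => _ /memv_imgP[v /[!memv_ker]/eqP-> ->]; rewrite linear0.
have kerW w : w \in W -> f w = 0 -> w = 0.
  by move=> wW fw; apply/eqP; rewrite -memv0 -kW0 memv_cap wW memv_ker fw eqxx.
have W0 j w : w \in W -> iter j f w = 0 -> w = 0.
  elim: j w => // j IH w wW; rewrite iterSr => fjw; apply: kerW => //.
  by apply: IH fjw; apply: (subvP fW); exact: memv_img.
move=> v; apply/eqP; rewrite -memv_ker.
have : v \in (lker f + W)%VS by rewrite kW1 memvf.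
case/memv_addP=> u uk [w wW ->]; rewrite (W0 k w wW (fk w)) addr0 //.
Qed.

Section Exact.
Variables (F : closedFieldType) (charF0 : [pchar F] =i pred0).
Variables (L : lieAlgType F) (N : lieIdeal L) (S R : {vspace L}).
Hypotheses (nilradN : is_nilradical N) (levi : levi_decomposition S R).
Hypothesis S_faithful :
  forall x, x \in S -> (forall y, y \in (N : {vspace L}) -> lieb x y = 0) -> x = 0.

Let n := (\dim N - \dim (lieprodv N N))%N.
Variables (phi : {linear L -> 'rV[F]_n}) (rho : {linear L -> 'M[F]_n}).
Hypothesis srep : section_rep (lieprodv N N) N phi rho.

Let idN : lie_ideal N. Proof. exact: lidealP. Qed.

Let radN x r : r \in R -> lieb x r \in (N : {vspace L}).
Proof. by case: levi => -[idR solR _] _ _ _; exact: bracket_solvable_nilradical. Qed.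

Let rho_nilradical x : x \in (N : {vspace L}) -> rho x = 0.
Proof.
by move=> xN; apply/(section_rep_eq0 idN srep) => y yN; exact: memv_lieprod.
Qed.

Let rhoM : lie_rep rho. Proof. exact: section_lie_rep idN srep. Qed.

(** The kernel K of S on N / [N, N] shifts the lower central series of N, so a
late term of its derived series acts as 0 on N, hence vanishes by exactness.
Thus K is a solvable ideal of S. *)
Lemma semisimple_part_rep_faithful s : s \in S -> rho s = 0 -> s = 0.
Proof.
move=> sS rs; have [_ [subS ssS] _ _] := levi.
pose K := (S :&: lker (linfun rho))%VS.
have inK y : (y \in K) = (y \in S) && (rho y == 0) by rewrite memv_cap memv_ker lfunE.
suff K0 : K = 0%VS by apply/eqP; rewrite -memv0 -K0 inK sS rs eqxx.
have idK x y : x \in S -> y \in K -> lieb x y \in K.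
  move=> xS; rewrite !inK => /andP[yS /eqP ry]; rewrite subS // rhoM ry.
  by rewrite mulmx0 mul0mx subrr eqxx.
have sK j : (iter j (fun W => lieprodv W W) K <= K)%VS.
  elim: j => // j IH; apply/lieprodvP => x y /(subvP IH) xK /(subvP IH) yK.
  by apply: idK => //; move: xK; rewrite inK => /andP[].
apply: ssS => //; first exact: capvSl.
have [_ [k Nk] _] := nilradN; exists k; apply/eqP; rewrite -subv0; apply/subvP => y yK.
rewrite memv0; apply/eqP; apply: S_faithful.
  by have := subvP (sK k) y yK; rewrite inK => /andP[].
move=> c cN; apply/eqP; rewrite -memv0.
have KN : {in K & N, forall y n, lieb y n \in lcs N 1}.
  move=> x z; rewrite inK => /andP[_ /eqP rx] zN.
  by move/(section_rep_eq0 idN srep): rx; exact.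
have := derived_lcs idN (i := 0) KN yK cN.
by rewrite add0n -addn1 => /(subvP (lcs_anti idN k 1)); rewrite /lcs Nk.
Qed.

(** Lift t to x = s + z in S + R, where z is central modulo N.  Then ad t is both
nilpotent and semisimple, which forces s = 0; finally x is in R and N + <x> is
a nilpotent ideal. *)
Lemma toric_nilpotent_eq0 (t : lieQuot N) :
  semisimple_end (ad t) -> nilpotent_mx (rho (vsval t)) -> t = 0.
Proof.
move=> sst [m rm]; have [radR [subS ssS] SR _] := levi.
set x := vsval t in rm; have tx : t = lie_pi N x by rewrite lie_piK.
have xsz : x \in (S + R)%VS by rewrite SR memvf.
have [s sS [z zR defx]] := memv_addP xsz.
have zN y : lieb z y \in (N : {vspace L}) by rewrite liebC rpredN radN.
have rho_iter k y :
    rho (iter k (lieb x) y) = iter k (fun X => X * rho x - rho x * X) (rho y).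
  by elim: k => //= k <-; rewrite rhoM.
have iter_s k u : u \in S ->
    iter k (lieb s) u \in S /\ iter k (lieb x) u - iter k (lieb s) u \in (N : {vspace L}).
  move=> uS; elim: k => [|k [IH1 IH2]] /=; first by rewrite subrr mem0v.
  split; first exact: subS.
  rewrite {1}defx liebDl addrAC -linearB; apply: rpredD; [exact: idN | exact: zN].
(* The (2m)-fold bracket of x with u in S acts as 0 on N / [N, N], and equals that
   of s modulo N; the latter lies in S, so it vanishes.  The extra step sends the
   R-component of y into N. *)
have ad_nil y : iter (m + m).+1 (lieb x) y \in (N : {vspace L}).
  have ySR : y \in (S + R)%VS by rewrite SR memvf.
  have [u uS [r rR ->]] := memv_addP ySR.
  rewrite linearD rpredD //=; last first.
    by rewrite -iterS iterSr iter_lieb_mem // radN.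
  have [vS vN] := iter_s (m + m)%N u uS.
  have v0 : iter (m + m) (lieb s) u = 0.
    apply: semisimple_part_rep_faithful => //; apply/eqP.
    have := rho_nilradical vN; rewrite linearB /= rho_iter commutator_iter_eq0 //.
    by rewrite sub0r => /eqP; rewrite oppr_eq0.
  by move: vN; rewrite v0 subr0; exact: idN.
have adt0 : forall q, ad t q = 0.
  apply: (semisimple_nilpotent_eq0 (k := (m + m).+1) sst) => q.
  have [y <-] := lie_pi_surj q.
  have -> : iter (m + m).+1 (ad t) (lie_pi N y) = lie_pi N (iter (m + m).+1 (lieb x) y).
    by elim: (m + m).+1 => // k IH; rewrite !iterS IH lie_piM adE tx.
  by apply/eqP; rewrite lie_pi_eq0.
have xN y : lieb x y \in (N : {vspace L}).
  by rewrite -lie_pi_eq0 lie_piM -tx -adE adt0.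
have s0 : s = 0.
  have sc u : u \in S -> lieb s u = 0.
    move=> uS; apply: semisimple_part_rep_faithful; first exact: subS.
    apply: rho_nilradical.
    have -> : lieb s u = lieb x u - lieb z u by rewrite defx liebDl addrK.
    by rewrite rpredB.
  have ls0 : (<[s]> = 0)%VS.
    apply: ssS; first by rewrite -memvE.
      move=> u _ uS /vlineP[a ->]; rewrite linearZ /= liebC sc // oppr0 scaler0.
      exact: mem0v.
    exists 1%N => /=; apply/eqP; rewrite -subv0.
    apply/lieprodvP => _ _ /vlineP[a ->] /vlineP[b ->].
    by rewrite liebZl linearZ /= liebb !scaler0 mem0v.
  by apply/eqP; rewrite -memv0 -ls0 memv_line.
have xrN y : lieb y x \in (N : {vspace L}) by rewrite liebC rpredN.
have xm : {in (N : {vspace L}), forall y, iter m (lieb x) y \in lcs N 1}.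
  move=> y yN; rewrite /lcs /= -(section_ker srep) ?iter_lieb_mem //.
  by rewrite (section_iter idN srep) // rm mulmx0.
have [_ nilN maxN] := nilradN.
have : x \in (N : {vspace L}).
  apply: (subvP (maxN _ (ideal_extension idN xrN) (nilpotent_extension idN nilN xrN xm))).
  by rewrite memvE addvSr.
by rewrite tx => xN'; apply/eqP; rewrite lie_pi_eq0.
Qed.

Lemma dim_toric (T : {vspace lieQuot N}) : lie_toric T -> (\dim T <= n)%N.
Proof.
case=> _ abT ssT.
pose f (t : lieQuot N) := rho (vsval t).
have f_lin : linear f.
  move=> a s t; rewrite /f.
  have -> : vsval (a *: s + t) = a *: vsval s + vsval t.
    exact: (linearP (@vsval F L (N^C)%VS)).
  exact: linearP.
pose rhoQ : {linear lieQuot N -> 'M[F]_n} :=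
  HB.pack f (GRing.isLinear.Build _ _ _ _ f f_lin).
apply: (@dim_commuting _ _ T n rhoQ) => [s t sT tT | t tT].
  apply/eqP; rewrite -subr_eq0 -rhoM rho_nilradical //.
  by rewrite -lie_pi_eq0 lie_piM !lie_piK abT.
exact: toric_nilpotent_eq0 (ssT t tT).
Qed.

End Exact.

Lemma exact_toric_bound (F : closedFieldType) (charF0 : [pchar F] =i pred0)
    (L : lieAlgType F) (N : lieIdeal L) (T : {vspace lieQuot N}) :
    is_nilradical N -> lie_exact N -> lie_toric T ->
  (\dim T <= \dim N - \dim (lieprodv N N))%N.
Proof.
move=> nilradN [S [R [levi faith]]] torT.
have idN : lie_ideal N by exact: lidealP.
have [phi [rho srep]] :=
  section_rep_exists (lie_ideal_lieprodv idN idN) (lieprodv_ideal N idN).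
exact: (dim_toric charF0 nilradN levi faith srep).
Qed.

Section Solvable.
Variables (F : closedFieldType) (charF0 : [pchar F] =i pred0).
Variables (L : lieAlgType F) (N : lieIdeal L).
Hypothesis solL : lie_solvable (fullv : {vspace L}).

(** Take S = 0 and R = L. *)
Lemma solvable_exact : lie_exact N.
Proof.
exists 0%VS, fullv; split; last by move=> x /[!memv0] /eqP.
split; [| | exact: add0v | exact: cap0v].
  by split=> // [|I _ _]; [exact: lie_ideal_fullv | exact: subvf].
split; first by move=> x y _ /[!memv0] /eqP ->; rewrite linear0.
by move=> I; rewrite subv0 => /eqP.
Qed.

Lemma solvable_quotient_toric :
  is_nilradical N -> lie_toric (fullv : {vspace lieQuot N}).
Proof.
move=> nilradN.
have ab (s t : lieQuot N) : lieb s t = 0.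
  have [[x <-] [y <-]] := (lie_pi_surj s, lie_pi_surj t).
  apply/eqP; rewrite -lie_piM lie_pi_eq0.
  apply: (@bracket_solvable_nilradical _ charF0 L N fullv) => //.
    exact: lie_ideal_fullv.
  exact: memvf.
split=> [x y _ _ | x y _ _ | t _ U _]; rewrite ?memvf //.
exists (U^C)%VS; split; [|exact: addv_complf|exact: capv_compl].
by apply/subvP => _ /memv_imgP[u _ ->]; rewrite adE ab mem0v.
Qed.

End Solvable.

Theorem theorem1 (F : closedFieldType) (charF0 : [pchar F] =i pred0)
    (L : lieAlgType F) (N : lieIdeal L) (nilradN : is_nilradical N) :
  (lie_exact N ->
     forall r : nat, is_toric_rank (lieQuot N) r ->
       (r <= \dim N - \dim (lieprodv N N))%N)
  /\
  (lie_solvable (fullv : {vspace L}) ->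
     [/\ lie_toric (fullv : {vspace (lieQuot N)}),
         forall r : nat,
           is_toric_rank (lieQuot N) r <-> r = \dim (fullv : {vspace (lieQuot N)}),
         forall r : nat, is_toric_rank (lieQuot N) r ->
           (r <= \dim N - \dim (lieprodv N N))%N
       & (\dim (fullv : {vspace (lieQuot N)})
            <= \dim N - \dim (lieprodv N N))%N]).
Proof.
have bound : lie_exact N -> forall r, is_toric_rank (lieQuot N) r ->
    (r <= \dim N - \dim (lieprodv N N))%N.
  by move=> exN r [T [torT _] ->]; exact: exact_toric_bound.
split=> // solL.
have exN := solvable_exact N solL.
have torQ := solvable_quotient_toric charF0 solL nilradN.
split=> //; first 1 last.
- exact: bound.
- exact: exact_toric_bound.
move=> r; split=> [[T [_ maxT] ->] | ->]; first by rewrite (maxT fullv torQ (subvf T)).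
exists fullv => //; split=> // T' _ fT'; apply/eqP; rewrite eqEsubv fT' subvf //.
Qed.
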